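(* Let $m_1\ge m_2\ge m_3>0$ with $m_1+m_2+m_3=1$, and let $C>0$. Consider the planar three-body problem in which the bodies of masses $m_1,m_2$ are point masses and the body of mass $m_3$ is oblate, with potential $U$ given in the context. Then for every fixed value $\bar I>0$ of the moment of inertia there exists a unique (up to rotations and reflections of the plane about the origin) triangular, i.e. non-collinear, central configuration $\mathbf z=(z_1,z_2,z_3)$ with $I(\mathbf z)=\bar I$, and the triangle with vertices $z_1,z_2,z_3$ is isosceles.
   Context: For $\mathbf z=(z_1,z_2,z_3)\in(\mathbb R^2)^3$ with $z_1,z_2,z_3$ pairwise distinct put $r_{ij}=\|z_i-z_j\|$. The potential of the three-body problem with oblate $m_3$ (gravitational constant normalized to $1$) is $$U(\mathbf z)=\frac{m_1m_2}{r_{12}}+m_1m_3\left(\frac1{r_{13}}+\frac{C}{r_{13}^3}\right)+m_2m_3\left(\frac1{r_{23}}+\frac{C}{r_{23}^3}\right),$$ where $C=R_3^2J_2/2>0$ is the constant measuring the oblateness of $m_3$ ($R_3$ its average radius, $J_2>0$ its zonal harmonic coefficient). The center of mass is fixed at the origin: $\sum_{i=1}^3 m_iz_i=0$. Let $\mathbf M=\mathrm{diag}(m_1,m_1,m_2,m_2,m_3,m_3)$. A configuration $\mathbf z$ with center of mass at the origin is a central configuration if there is $\omega\in\mathbb R$ with $\nabla U(\mathbf z)+\omega^2\mathbf M\mathbf z=0$. The moment of inertia is $I(\mathbf z)=\mathbf z^T\mathbf M\mathbf z=\sum_i m_i\|z_i\|^2$, which (with center of mass at the origin and total mass $1$) equals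 $\sum_{i<j}m_im_jr_{ij}^2$. *)

(* Defs.v *)
From mathcomp Require Import all_boot all_order all_algebra.
From mathcomp Require Import all_classical all_reals all_analysis.

Set Implicit Arguments.
Unset Strict Implicit.
Unset Printing Implicit Defensive.

Import Order.TTheory GRing.Theory Num.Theory.
Import numFieldNormedType.Exports.

Local Open Scope ring_scope.

Definition body1 : 'I_3 := @Ordinal 3 0 isT.
Definition body2 : 'I_3 := @Ordinal 3 1 isT.
Definition body3 : 'I_3 := @Ordinal 3 2 isT.

(* A configuration (z_1, z_2, z_3) in (R^2)^3 is a 3 x 2 matrix whose i-th row
   is z_i.  The masses form a row vector m, and the 6 x 6 matrix
   diag(m_1, m_1, m_2, m_2, m_3, m_3) acts on such a configuration as left
   multiplication by the 3 x 3 matrix [diag_mx m]. *)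

(* The library norm on matrices is the sup norm, hence this definition. *)
Definition enorm (R : realType) (v : 'rV[R]_2) : R :=
  Num.sqrt (\sum_(k < 2) v 0 k ^+ 2).

Definition edist (R : realType) (z : 'M[R]_(3, 2)) (i j : 'I_3) : R :=
  enorm (row i z - row j z).

Definition potential (R : realType) (m : 'rV[R]_3) (C : R)
    (z : 'M[R]_(3, 2)) : R :=
  m 0 body1 * m 0 body2 / edist z body1 body2
  + m 0 body1 * m 0 body3 *
      (1 / edist z body1 body3 + C / edist z body1 body3 ^+ 3)
  + m 0 body2 * m 0 body3 *
      (1 / edist z body2 body3 + C / edist z body2 body3 ^+ 3).

(* Entry (i, k) is the partial derivative with respect to the k-th coordinate
   of z_i.  The directional derivative is a total function, but it is only
   used below at collision-free configurations, where [potential] is smooth. *)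
Definition gradient (R : realType) (F : 'M[R]_(3, 2) -> R)
    (z : 'M[R]_(3, 2)) : 'M[R]_(3, 2) :=
  \matrix_(i < 3, k < 2) 'D_(delta_mx i k) F z.

Definition central_configuration (R : realType) (m : 'rV[R]_3) (C : R)
    (z : 'M[R]_(3, 2)) : Prop :=
  [/\ injective (fun i : 'I_3 => row i z),
      \sum_(i < 3) m 0 i *: row i z = 0 &
      exists omega : R,
        gradient (potential m C) z + omega ^+ 2 *: (diag_mx m *m z) = 0].

Definition moment_of_inertia (R : realType) (m : 'rV[R]_3)
    (z : 'M[R]_(3, 2)) : R :=
  \sum_(i < 3) m 0 i * enorm (row i z) ^+ 2.

Definition collinear (R : realType) (z : 'M[R]_(3, 2)) : Prop :=
  exists p v : 'rV[R]_2,
    v != 0 /\ forall i : 'I_3, exists t : R, row i z = p + t *: v.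

Definition isosceles (R : realType) (z : 'M[R]_(3, 2)) : Prop :=
  [\/ edist z body1 body2 = edist z body1 body3,
      edist z body1 body2 = edist z body2 body3 |
      edist z body1 body3 = edist z body2 body3].

(* Vectors are rows, so the linear isometries of the plane (the rotations about
   the origin and the reflections in lines through it) act on the right. *)
Definition congruent_about_origin (R : realType) (z w : 'M[R]_(3, 2)) : Prop :=
  exists Q : 'M[R]_2, Q *m Q^T = 1%:M /\ w = z *m Q.

(* Main.v *)
Require Import Defs.
From mathcomp Require Import all_boot all_order all_algebra.
From mathcomp Require Import all_classical all_reals all_analysis.
From mathcomp Require Import ring lra.

(* Subtracting the center of mass from the equations of a central configuration
   leaves, for each body, a linear relation between the two edges at that body.
   For a genuine triangle the edges are independent, so all the coefficients
   vanish: 1/r12^3 = 1/r13^3 + 3C/r13^5 = 1/r23^3 + 3C/r23^5 = omega^2.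
   Monotonicity of r |-> 1/r^3 + 3C/r^5 gives r13 = r23 =: s, and the ratio
   u = s/r12 exceeds 1.  In terms of u, r12^2 (u^5 - u^2) = 3C and the moment of
   inertia is 3C (m1 m2 + (m1 + m2) m3 u^2)/(u^5 - u^2), which decreases
   from +oo to 0 on ]1, +oo[: each value determines u, hence all distances,
   hence the triangle up to an isometry. *)

Set Implicit Arguments.
Unset Strict Implicit.
Unset Printing Implicit Defensive.

Import Order.TTheory GRing.Theory Num.Theory.
Import numFieldNormedType.Exports.

Local Open Scope ring_scope.

(* [edist] alone now denotes the extended distance of MathComp-Analysis. *)
Local Notation edist := Defs.edist.

(** * Case analysis on bodies and coordinates; distances between bodies *)

Lemma ord2P (P : 'I_2 -> Prop) : P 0 -> P 1 -> forall k, P k.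
Proof.
move=> P0 P1 [[|[|//]] lt]; [move: P0|move: P1]; congr P; exact: val_inj.
Qed.

Lemma bodyP (P : 'I_3 -> Prop) : P body1 -> P body2 -> P body3 -> forall i, P i.
Proof.
move=> P1 P2 P3 [[|[|[|//]]] lt]; [move: P1|move: P2|move: P3]; congr P; exact: val_inj.
Qed.

Lemma sum_bodies (V : nmodType) (F : 'I_3 -> V) :
  \sum_(i < 3) F i = F body1 + F body2 + F body3.
Proof.
rewrite !big_ord_recl big_ord0 addr0 addrA.
by congr (_ + _ + _); congr F; exact: val_inj.
Qed.

Lemma edistE (R : realType) (z : 'M[R]_(3, 2)) (i j : 'I_3) :
  edist z i j = Num.sqrt ((z i 0 - z j 0) ^+ 2 + (z i 1 - z j 1) ^+ 2).
Proof.
rewrite /edist /enorm big_ord_recl big_ord1 !mxE.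
by congr (Num.sqrt (_ + (z i _ - z j _) ^+ 2)); exact: val_inj.
Qed.

Lemma sqr_edist (R : realType) (z : 'M[R]_(3, 2)) (i j : 'I_3) :
  edist z i j ^+ 2 = (z i 0 - z j 0) ^+ 2 + (z i 1 - z j 1) ^+ 2.
Proof. by rewrite edistE sqr_sqrtr // addr_ge0 ?sqr_ge0. Qed.

Lemma edistC (R : realType) (z : 'M[R]_(3, 2)) (i j : 'I_3) :
  edist z i j = edist z j i.
Proof. by rewrite !edistE; congr (Num.sqrt (_ + _)); ring. Qed.

Lemma edistxx (R : realType) (z : 'M[R]_(3, 2)) (i : 'I_3) : edist z i i = 0.
Proof. by rewrite edistE !subrr expr0n addr0 sqrtr0. Qed.

Lemma edist_gt0 (R : realType) (z : 'M[R]_(3, 2)) (i j : 'I_3) :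
  row i z != row j z -> 0 < edist z i j.
Proof.
move=> zij; rewrite edistE sqrtr_gt0 lt_neqAle addr_ge0 ?sqr_ge0 // andbT eq_sym.
rewrite paddr_eq0 ?sqr_ge0 // !sqrf_eq0 !subr_eq0.
apply: contra zij => /andP[/eqP E0 /eqP E1].
by apply/eqP/rowP; apply: ord2P; rewrite !mxE.
Qed.

(** * Collinearity as the vanishing of a determinant *)

(** Twice the signed area of the triangle, as the cross product of the two edges at [body1]. *)
Definition edge_det (R : realType) (z : 'M[R]_(3, 2)) : R :=
  (z body1 0 - z body2 0) * (z body1 1 - z body3 1)
  - (z body1 1 - z body2 1) * (z body1 0 - z body3 0).

Lemma collinear_edge_det0 (R : realType) (z : 'M[R]_(3, 2)) :
  collinear z -> edge_det z = 0.
Proof.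
move=> [p [v [_ H]]]; rewrite /edge_det.
have E i : exists t, forall k, z i k = p 0 k + t * v 0 k.
  by have [t /rowP Et] := H i; exists t => k; have := Et k; rewrite !mxE.
have [a Ea] := E body1; have [b Eb] := E body2; have [c Ec] := E body3.
by rewrite !Ea !Eb !Ec; ring.
Qed.

Lemma edge_det0_collinear (R : realType) (z : 'M[R]_(3, 2)) :
  row body1 z != row body2 z -> edge_det z = 0 -> collinear z.
Proof.
move=> z12 A0; exists (row body1 z), (row body1 z - row body2 z).
split; first by rewrite subr_eq0.
pose n := (z body1 0 - z body2 0) ^+ 2 + (z body1 1 - z body2 1) ^+ 2.
have n0 : n != 0 by rewrite /n -sqr_edist expf_neq0 // lt0r_neq0 // edist_gt0.
apply: bodyP.
- by exists 0; rewrite scale0r addr0.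
- by exists (-1); rewrite scaleN1r opprB addrC subrK.
(* Coefficient of the orthogonal projection of the third body onto the line. The projection misses
   that body by a multiple of [edge_det z], hence by 0. *)
- exists (((z body1 0 - z body2 0) * (z body3 0 - z body1 0)
       + (z body1 1 - z body2 1) * (z body3 1 - z body1 1)) / n).
  apply/rowP; apply: ord2P; rewrite !mxE.
    transitivity (z body1 0 +
      ((z body3 0 - z body1 0) * n - (z body1 1 - z body2 1) * edge_det z) / n).
      by rewrite A0 mulr0 subr0 mulfK // addrC subrK.
    by congr (_ + _); rewrite mulrAC; congr (_ / _); rewrite /n /edge_det; ring.
  transitivity (z body1 1 +
    ((z body3 1 - z body1 1) * n + (z body1 0 - z body2 0) * edge_det z) / n).
    by rewrite A0 mulr0 addr0 mulfK // addrC subrK.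
  by congr (_ + _); rewrite mulrAC; congr (_ / _); rewrite /n /edge_det; ring.
Qed.

Lemma edge_det_inj (R : realType) (z : 'M[R]_(3, 2)) :
  edge_det z != 0 -> injective (fun i : 'I_3 => row i z).
Proof.
move=> A0 i j /rowP E.
have {}E k : z i k = z j k by have := E k; rewrite !mxE.
apply/eqP; move: i j E; apply: bodyP; apply: bodyP => // E; case/eqP: A0;
  by rewrite /edge_det !E; ring.
Qed.

(** * Center of mass, moment of inertia and congruence *)

Lemma center_of_massE (R : realType) (m : 'rV[R]_3) (z : 'M[R]_(3, 2)) :
  \sum_(i < 3) m 0 i *: row i z = 0 <->
  forall k, m 0 body1 * z body1 k + m 0 body2 * z body2 k + m 0 body3 * z body3 k = 0.
Proof.
rewrite sum_bodies; split=> [/rowP E k|E]; last apply/rowP => k.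
  by have := E k; rewrite !mxE.
by rewrite !mxE E.
Qed.

(* Lagrange's identity, with total mass 1. *)
Lemma moment_of_inertiaE (R : realType) (m : 'rV[R]_3) (z : 'M[R]_(3, 2)) :
  \sum_(i < 3) m 0 i = 1 -> \sum_(i < 3) m 0 i *: row i z = 0 ->
  moment_of_inertia m z = m 0 body1 * m 0 body2 * edist z body1 body2 ^+ 2
   + m 0 body1 * m 0 body3 * edist z body1 body3 ^+ 2
   + m 0 body2 * m 0 body3 * edist z body2 body3 ^+ 2.
Proof.
rewrite sum_bodies => m1 /center_of_massE cm.
have nE i : enorm (row i z) ^+ 2 = z i 0 ^+ 2 + z i 1 ^+ 2.
  rewrite /enorm sqr_sqrtr ?sumr_ge0 // => [|k _]; last exact: sqr_ge0.
  by rewrite big_ord_recl big_ord1 !mxE; congr (_ + z i _ ^+ 2); exact: val_inj.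
rewrite /moment_of_inertia sum_bodies !nE !sqr_edist.
(* Multiplying by the total mass makes both sides quadratic in the masses; they then differ by the
   squared norm of [\sum_i m_i z_i], which vanishes. *)
rewrite -[LHS]mul1r -m1.
transitivity (
   m 0 body1 * m 0 body2 * ((z body1 0 - z body2 0) ^+ 2 + (z body1 1 - z body2 1) ^+ 2)
   + m 0 body1 * m 0 body3 * ((z body1 0 - z body3 0) ^+ 2 + (z body1 1 - z body3 1) ^+ 2)
   + m 0 body2 * m 0 body3 * ((z body2 0 - z body3 0) ^+ 2 + (z body2 1 - z body3 1) ^+ 2)
   + (m 0 body1 * z body1 0 + m 0 body2 * z body2 0 + m 0 body3 * z body3 0) ^+ 2
   + (m 0 body1 * z body1 1 + m 0 body2 * z body2 1 + m 0 body3 * z body3 1) ^+ 2).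
  by ring.
by rewrite !cm; ring.
Qed.

(** A linear isometry matching the edges also matches the positions: with total mass 1 and center of
    mass at the origin, each vertex is a fixed linear combination of edges. *)
Lemma congruent_of_distances (R : realType) (m : 'rV[R]_3) (z w : 'M[R]_(3, 2)) :
  \sum_(i < 3) m 0 i = 1 ->
  \sum_(i < 3) m 0 i *: row i z = 0 -> \sum_(i < 3) m 0 i *: row i w = 0 ->
  edge_det z != 0 ->
  (forall i j, edist z i j = edist w i j) ->
  congruent_about_origin z w.
Proof.
rewrite [X in X = 1 -> _]sum_bodies => m1 /center_of_massE cz /center_of_massE cw A0 d.
(* The Gram matrices of the edges agree, so [invmx (edges z) *m edges w] is
   orthogonal. *)
pose edges (x : 'M[R]_(3, 2)) : 'M[R]_2 :=
  \matrix_(i, k) (x body1 k - (if i == 0 then x body2 k else x body3 k)).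
have E1 : lift ord0 ord0 = 1 :> 'I_2 by exact: val_inj.
have E2 : lift 1 0 = 0 :> 'I_2 by exact: val_inj.
have Gram : edges z *m (edges z)^T = edges w *m (edges w)^T.
  have q i j : (z i 0 - z j 0) ^+ 2 + (z i 1 - z j 1) ^+ 2
      = (w i 0 - w j 0) ^+ 2 + (w i 1 - w j 1) ^+ 2 by rewrite -!sqr_edist d.
  have q12 := q body1 body2; have q13 := q body1 body3; have q23 := q body2 body3.
  (* The off-diagonal entries come from the third side by the law of cosines, which is linear in the
     squared lengths. *)
  by apply/matrixP; apply: ord2P; apply: ord2P;
    rewrite !mxE !big_ord_recl !big_ord0 !mxE E1 /=; lra.
have detE : \det (edges z) = edge_det z.
  rewrite (expand_det_row _ 0) !big_ord_recl big_ord0 /cofactor.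
  rewrite !det_mx11 !mxE /= /edge_det.
  by rewrite [lift ord0 0]E1 ?E1 [lift 1 0]E2 expr0 expr1; ring.
have U : edges z \in unitmx by rewrite unitmxE detE unitfE.
pose Q := invmx (edges z) *m edges w.
have zQ : edges z *m Q = edges w by rewrite mulmxA mulmxV // mul1mx.
exists Q; split.
  rewrite trmx_mul mulmxA -(mulmxA (invmx _)) -Gram mulmxA mulVmx // mul1mx.
  by rewrite -trmx_mul mulVmx // trmx1.
have first_body (x : 'M[R]_(3, 2)) k :
    m 0 body1 * x body1 k + m 0 body2 * x body2 k + m 0 body3 * x body3 k = 0 ->
    x body1 k = m 0 body2 * edges x 0 k + m 0 body3 * edges x 1 k.
  by move=> cm; rewrite !mxE /= -[LHS]mul1r -m1 -[RHS]add0r -cm; ring.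
have w1 : row body1 w = row body1 z *m Q.
  have row1 (x : 'M[R]_(3, 2)) :
     (forall k, m 0 body1 * x body1 k + m 0 body2 * x body2 k + m 0 body3 * x body3 k = 0) ->
     row body1 x = m 0 body2 *: row 0 (edges x) + m 0 body3 *: row 1 (edges x).
    by move=> cm; apply/rowP => k; rewrite [LHS]mxE first_body // !mxE.
  by rewrite !row1 // mulmxDl -!scalemxAl -!row_mul zQ.
apply/row_matrixP; apply: bodyP; rewrite row_mul //.
- have row2 (x : 'M[R]_(3, 2)) : row body2 x = row body1 x - row 0 (edges x).
    by apply/rowP => k; rewrite !mxE /= subKr.
  by rewrite (row2 z) (row2 w) mulmxBl -w1 -row_mul zQ.
- have row3 (x : 'M[R]_(3, 2)) : row body3 x = row body1 x - row 1 (edges x).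
    by apply/rowP => k; rewrite !mxE /= subKr.
  by rewrite (row3 z) (row3 w) mulmxBl -w1 -row_mul zQ.
Qed.

(** * The gradient of the potential *)

(** Reduces a directional derivative on configurations to one-variable calculus. *)
Lemma is_derive_line (R : realType) (V : normedModType R) (F : V -> R) (z v : V) (l : R) :
  is_derive (0 : R) 1 (fun h => F (h *: v + z)) l -> is_derive z v F l.
Proof.
have E : (fun h : R =>
    h^-1 *: (((fun h => F (h *: v + z)) \o shift 0) (h *: 1) - F (0 *: v + z)))
  = (fun h : R => h^-1 *: ((F \o shift z) (h *: v) - F z)).
  by apply/funext => h /=; rewrite scale0r add0r addr0 [_%:A]mulr1.
case; rewrite /derivable /derive E => ? ?; exact: DeriveDef.
Qed.

Lemma is_derive_pair_potential (R : realType) (C x y p q : R) :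
  0 < x ^+ 2 + y ^+ 2 ->
  is_derive (0 : R) 1
    (fun h => 1 / Num.sqrt ((x + h * p) ^+ 2 + (y + h * q) ^+ 2)
       + C / Num.sqrt ((x + h * p) ^+ 2 + (y + h * q) ^+ 2) ^+ 3)
    (- ((Num.sqrt (x ^+ 2 + y ^+ 2)) ^- 3 + 3 * C * (Num.sqrt (x ^+ 2 + y ^+ 2)) ^- 5)
      * (x * p + y * q)).
Proof.
move=> s0; set r := Num.sqrt _.
have r0 : 0 < r by rewrite sqrtr_gt0.
(* The squared distance along the line is a polynomial in [h], so its derivative is formal; the
   chain rule then goes through the square root and [s^-1 + C * s^-1 ^+ 3]. *)
pose P : {poly R} := (x%:P + 'X * p%:P) ^+ 2 + (y%:P + 'X * q%:P) ^+ 2.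
have P0 : P.[0] = x ^+ 2 + y ^+ 2 by rewrite /P !hornerE; ring.
have dP0 : (deriv P).[0] = 2 * (x * p + y * q).
  by rewrite /P !poly.derivE !hornerE /=; ring.
have dV : is_derive r 1 (fun s : R => s^-1) (- r ^- 2).
  apply: is_derive_eq; first exact: (@is_deriveV _ id r 1 1 (lt0r_neq0 r0)).
  by rewrite [_%:A]mulr1.
have dphi : is_derive r 1 (fun s : R => s^-1 + C * (s^-1) ^+ 3)
    (- r ^- 2 - 3 * C * r ^- 4).
  have -> : (fun s : R => s^-1 + C * (s^-1) ^+ 3)
      = (fun s => s^-1) + C \*: (fun s => s^-1) ^+ 3 by [].
  by apply: is_derive_eq; rewrite /= -![_ *: _]/(_ * _); field; exact: lt0r_neq0.
have dS : is_derive P.[0] 1 Num.sqrt (2 * r)^-1.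
  by rewrite P0; exact: is_derive1_sqrt.
have dcomp := is_derive1_comp dS (is_derive_poly P 0).
have dphi' : is_derive ((Num.sqrt \o horner P) 0) 1
    (fun s : R => s^-1 + C * (s^-1) ^+ 3)
    (- r ^- 2 - 3 * C * r ^- 4) by rewrite /= P0.
have := is_derive1_comp dphi' dcomp.
have -> : (fun s : R => s^-1 + C * s^-1 ^+ 3) \o (Num.sqrt \o horner P) =
   (fun h => 1 / Num.sqrt ((x + h * p) ^+ 2 + (y + h * q) ^+ 2)
       + C / Num.sqrt ((x + h * p) ^+ 2 + (y + h * q) ^+ 2) ^+ 3).
  by apply/funext => h /=; rewrite exprVn /P div1r !hornerE.
by move=> H; apply: is_derive_eq H _; rewrite dP0; field; exact: lt0r_neq0.
Qed.

Lemma is_derive_edist_potential (R : realType) (C : R) (z v : 'M[R]_(3, 2)) (i j : 'I_3) :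
  row i z != row j z ->
  is_derive z v (fun w => 1 / edist w i j + C / edist w i j ^+ 3)
    (- (edist z i j ^- 3 + 3 * C * edist z i j ^- 5)
      * ((z i 0 - z j 0) * (v i 0 - v j 0) + (z i 1 - z j 1) * (v i 1 - v j 1))).
Proof.
move=> zij; apply: is_derive_line.
have q0 : 0 < (z i 0 - z j 0) ^+ 2 + (z i 1 - z j 1) ^+ 2.
  by rewrite -sqr_edist exprn_gt0 // edist_gt0.
rewrite edistE; have := is_derive_pair_potential C (v i 0 - v j 0) (v i 1 - v j 1) q0.
congr (is_derive _ _ _ _); apply/funext => h; rewrite edistE !mxE.
have E k : h * v i k + z i k - (h * v j k + z j k) = z i k - z j k + h * (v i k - v j k).
  ring.
by rewrite !E.
Qed.

Lemma derive_potential (R : realType) (m : 'rV[R]_3) (C : R) (z v : 'M[R]_(3, 2)) :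
  injective (fun i : 'I_3 => row i z) ->
  let D (c : R) i j := (edist z i j ^- 3 + 3 * c * edist z i j ^- 5)
      * ((z i 0 - z j 0) * (v i 0 - v j 0) + (z i 1 - z j 1) * (v i 1 - v j 1)) in
  'D_v (potential m C) z = - (m 0 body1 * m 0 body2 * D 0 body1 body2
     + m 0 body1 * m 0 body3 * D C body1 body3 + m 0 body2 * m 0 body3 * D C body2 body3).
Proof.
move=> inj D.
have d c i j : i != j ->
    is_derive z v (fun w => 1 / edist w i j + c / edist w i j ^+ 3) (- D c i j).
  by move=> ij; rewrite -mulNr; apply: is_derive_edist_potential; rewrite (inj_eq inj).
have d12 := d 0 body1 body2 isT.
have d13 := d C body1 body3 isT.
have d23 := d C body2 body3 isT.
(* A point-mass pair is an oblate pair with constant 0. *)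
have -> : potential m C =
   (m 0 body1 * m 0 body2) \*:
     (fun w => 1 / edist w body1 body2 + 0 / edist w body1 body2 ^+ 3)
   + (m 0 body1 * m 0 body3) \*:
     (fun w => 1 / edist w body1 body3 + C / edist w body1 body3 ^+ 3)
   + (m 0 body2 * m 0 body3) \*:
     (fun w => 1 / edist w body2 body3 + C / edist w body2 body3 ^+ 3).
  apply/funext => w.
  have E12 : m 0 body1 * m 0 body2 / edist w body1 body2
      = m 0 body1 * m 0 body2 * (1 / edist w body1 body2 + 0 / edist w body1 body2 ^+ 3).
    by rewrite mul0r addr0 div1r.
  by rewrite /potential E12.
apply: derive_val; apply: is_derive_eq.
by rewrite !scalerN -!opprD.
Qed.

(** The difference of Kronecker symbols is 1, -1 or 0 as [i] is [a], [b] or the body outside the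
    pair, so one formula serves all three bodies. *)
Lemma gradient_potentialE (R : realType) (m : 'rV[R]_3) (C : R)
    (z : 'M[R]_(3, 2)) (i : 'I_3) (k : 'I_2) :
  injective (fun i : 'I_3 => row i z) ->
  let D (c : R) a b := (edist z a b ^- 3 + 3 * c * edist z a b ^- 5)
      * ((z a k - z b k) * ((a == i)%:R - (b == i)%:R)) in
  gradient (potential m C) z i k = - (m 0 body1 * m 0 body2 * D 0 body1 body2
     + m 0 body1 * m 0 body3 * D C body1 body3 + m 0 body2 * m 0 body3 * D C body2 body3).
Proof.
move=> inj D; rewrite mxE derive_potential //.
have E a b : (z a 0 - z b 0) * (delta_mx i k a 0 - delta_mx i k b 0)
  + (z a 1 - z b 1) * (delta_mx i k a 1 - delta_mx i k b 1)
   = (z a k - z b k) * ((a == i)%:R - (b == i)%:R) :> R.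
  rewrite !mxE; move: k {D}; apply: ord2P.
    by rewrite eqxx !andbT !andbF subrr mulr0 addr0.
  by rewrite eqxx !andbT !andbF subrr mulr0 add0r.
by rewrite !E.
Qed.

(** * The equations of a triangular central configuration *)

(** Cramer's rule; the two vectors will be the edges at one body. *)
Lemma linear_comb_eq0 (R : fieldType) (a b x0 x1 y0 y1 : R) :
  x0 * y1 - x1 * y0 != 0 -> a * x0 + b * y0 = 0 -> a * x1 + b * y1 = 0 -> a = 0 /\ b = 0.
Proof.
move=> d E0 E1; split; apply/eqP; rewrite -(mulIr_eq0 _ (mulIf d)); apply/eqP.
  transitivity ((a * x0 + b * y0) * y1 - (a * x1 + b * y1) * y0); first by ring.
  by rewrite E0 E1; ring.
transitivity ((a * x1 + b * y1) * x0 - (a * x0 + b * y0) * x1); first by ring.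
by rewrite E0 E1; ring.
Qed.

Lemma triangular_central_configurationP (R : realType) (m : 'rV[R]_3) (C : R)
    (z : 'M[R]_(3, 2)) :
  (forall i, 0 < m 0 i) -> \sum_(i < 3) m 0 i = 1 -> 0 <= C ->
  \sum_(i < 3) m 0 i *: row i z = 0 -> edge_det z != 0 ->
  let r := edist z in
  let force c i j := r i j ^- 3 + 3 * c * r i j ^- 5 in
  central_configuration m C z <->
  force 0 body1 body2 = force C body1 body3 /\ force C body2 body3 = force C body1 body3.
Proof.
move=> mp m1 C0 cm A0 r force; have inj := edge_det_inj A0.
rewrite sum_bodies in m1; have /center_of_massE cmE := cm.
set k12 := force _ _ _; set k13 := force _ _ _; set k23 := force _ _ _.
have gE := gradient_potentialE m C _ _ inj.
(* Here [w] stands for the square of the angular velocity, and each equation is rewritten in terms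
   of the edges at one body. *)
have eqs w : gradient (potential m C) z + w *: (diag_mx m *m z) = 0 <->
   forall k, [/\
    m 0 body1 * ((w - k12) * m 0 body2 * (z body1 k - z body2 k)
      + (w - k13) * m 0 body3 * (z body1 k - z body3 k)) = 0,
    m 0 body2 * ((w - k12) * m 0 body1 * (z body2 k - z body1 k)
      + (w - k23) * m 0 body3 * (z body2 k - z body3 k)) = 0 &
    m 0 body3 * ((w - k13) * m 0 body1 * (z body3 k - z body1 k)
      + (w - k23) * m 0 body2 * (z body3 k - z body2 k)) = 0].
  (* The total mass 1 and the zero center of mass are inserted so that [z i k] becomes the sum of
     the [m_j (z_i - z_j)]. *)
  have lhs i k : (gradient (potential m C) z + w *: (diag_mx m *m z)) i k
      = - (m 0 body1 * m 0 body2 *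
           (k12 * ((z body1 k - z body2 k) * ((body1 == i)%:R - (body2 == i)%:R)))
         + m 0 body1 * m 0 body3 *
           (k13 * ((z body1 k - z body3 k) * ((body1 == i)%:R - (body3 == i)%:R)))
         + m 0 body2 * m 0 body3 *
           (k23 * ((z body2 k - z body3 k) * ((body2 == i)%:R - (body3 == i)%:R))))
       + w * m 0 i * ((m 0 body1 + m 0 body2 + m 0 body3) * z i k
          - (m 0 body1 * z body1 k + m 0 body2 * z body2 k + m 0 body3 * z body3 k)).
    by rewrite cmE m1 subr0 mul1r mxE gE mul_diag_mx !mxE mulrA.
  split=> [/matrixP E k|E].
    by split; [have := E body1 k|have := E body2 k|have := E body3 k];
      rewrite lhs !mxE /= => <-; ring.
  apply/matrixP => i k; rewrite lhs !mxE; have [E1 E2 E3] := E k.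
  by move: i; apply: bodyP => /=; [rewrite -[RHS]E1|rewrite -[RHS]E2|rewrite -[RHS]E3]; ring.
have mn0 i : m 0 i != 0 by rewrite lt0r_neq0.
have m0 i x : (m 0 i * x == 0) = (x == 0) by rewrite mulf_eq0 (negPf (mn0 i)).
split=> [[_ _ [w /eqs E]]|[E12 E23]].
  have [w12 w13] : (w ^+ 2 - k12) * m 0 body2 = 0 /\ (w ^+ 2 - k13) * m 0 body3 = 0.
    by apply: (@linear_comb_eq0 _ _ _ _ _ _ _ A0);
      apply/eqP; rewrite -(m0 body1); apply/eqP; [have [] := E 0|have [] := E 1].
  (* The edges at [body3] have the same determinant as those at [body1], and their relation brings
     in the remaining coefficient [k23]. *)
  have [_ w23] : (w ^+ 2 - k13) * m 0 body1 = 0 /\ (w ^+ 2 - k23) * m 0 body2 = 0.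
    apply: (@linear_comb_eq0 _ _ _ (z body3 0 - z body1 0) (z body3 1 - z body1 1)
      (z body3 0 - z body2 0) (z body3 1 - z body2 1)).
    - by apply: contra A0 => /eqP <-; rewrite /edge_det; apply/eqP; ring.
    - by apply/eqP; rewrite -(m0 body3); apply/eqP; have [] := E 0.
    - by apply/eqP; rewrite -(m0 body3); apply/eqP; have [] := E 1.
  move/eqP: w12; rewrite mulrC m0 subr_eq0 => /eqP <-.
  move/eqP: w13; rewrite mulrC m0 subr_eq0 => /eqP <-.
  by move/eqP: w23; rewrite mulrC m0 subr_eq0 => /eqP <-.
(* Conversely, the common value of the three coefficients is nonnegative because [0 <= C], so it is
   the square of some [omega]. *)
split=> //; exists (Num.sqrt k13); rewrite sqr_sqrtr; last first.
  by rewrite addr_ge0 ?mulr_ge0 ?invr_ge0 ?exprn_ge0 ?sqrtr_ge0.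
by apply/eqs => k; rewrite E12 E23; split; ring.
Qed.

(** * Solving for the side lengths *)

(** The first term strictly decreases with the distance and the second does not increase. This
    forces the two sides at the oblate body to be equal. *)
Lemma oblate_force_inj (R : realFieldType) (C r s : R) : 0 <= C -> 0 < r -> 0 < s ->
  r ^- 3 + 3 * C * r ^- 5 = s ^- 3 + 3 * C * s ^- 5 -> r = s.
Proof.
move=> C0 r0 s0.
have dec (x y : R) : 0 < x -> x < y ->
   y ^- 3 + 3 * C * y ^- 5 < x ^- 3 + 3 * C * x ^- 5.
  move=> x0 xy; have y0 := lt_trans x0 xy.
  apply: ltr_leD; first by rewrite ltf_pV2 ?posrE ?exprn_gt0 // ltrXn2r // ltW.
  apply: ler_wpM2l; first by rewrite mulr_ge0.
  by rewrite lef_pV2 ?posrE ?exprn_gt0 // lerXn2r ?nnegrE ?ltW.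
move=> E; case: (ltgtP r s) => [rs|sr|] //.
  by have := dec _ _ r0 rs; rewrite E ltxx.
by have := dec _ _ s0 sr; rewrite E ltxx.
Qed.

(** The oblateness term is positive, so [s ^- 3 < r ^- 3]; the second claim is the force equation
    multiplied by [s ^+ 5]. *)
Lemma ratio_gt1 (R : realFieldType) (C r s : R) : 0 < C -> 0 < r -> 0 < s ->
  r ^- 3 = s ^- 3 + 3 * C * s ^- 5 ->
  1 < s / r /\ r ^+ 2 * ((s / r) ^+ 5 - (s / r) ^+ 2) = 3 * C.
Proof.
move=> C0 r0 s0 E.
have r1 := lt0r_neq0 r0; have s1 := lt0r_neq0 s0.
split.
  have : s ^- 3 < r ^- 3 by rewrite E ltrDl mulr_gt0 ?mulr_gt0 ?invr_gt0 ?exprn_gt0.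
  rewrite ltf_pV2 ?posrE ?exprn_gt0 // => rs.
  rewrite ltr_pdivlMr // mul1r ltNge; apply/negP => sr.
  by move: rs; rewrite ltNge => /negP; apply; rewrite lerXn2r // nnegrE ltW.
have := congr1 (fun t => t * (s ^+ 5)) E.
have -> : (s ^- 3 + 3 * C * s ^- 5) * s ^+ 5 = s ^+ 2 + 3 * C by field.
have -> : r ^+ 2 * ((s / r) ^+ 5 - (s / r) ^+ 2) = r ^- 3 * s ^+ 5 - s ^+ 2.
  by field; rewrite r1.
by move=> ->; ring.
Qed.

(* (A + B u^2)/(u^5 - u^2) = (A/u^2 + B)/(u^3 - 1) is decreasing for u > 1. *)
Lemma ratio_unique (R : realFieldType) (A B K u v : R) :
  0 < A -> 0 < B -> 0 < K -> 1 < u -> 1 < v ->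
  K * (u ^+ 5 - u ^+ 2) = A + B * u ^+ 2 ->
  K * (v ^+ 5 - v ^+ 2) = A + B * v ^+ 2 -> u = v.
Proof.
move=> A0 B0 K0 u1 v1.
have inc (x y : R) : 1 < x -> x < y -> K * (x ^+ 5 - x ^+ 2) = A + B * x ^+ 2 ->
   K * (y ^+ 5 - y ^+ 2) = A + B * y ^+ 2 -> False.
  move=> x1 xy Ex Ey.
  have x0 : 0 < x by lra.
  have y0 : 0 < y by lra.
  have x2 : 0 < x ^+ 2 by rewrite exprn_gt0.
  have xy2 : x ^+ 2 < y ^+ 2 by rewrite ltrXn2r // ltW.
  have xy3 : x ^+ 3 < y ^+ 3 by rewrite ltrXn2r // ltW.
  (* Cross-multiplying eliminates [K]; the sum of [A] times [h1] and [B] times [h2] contradicts the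
     result. *)
  have : (A + B * x ^+ 2) * (y ^+ 2 * (y ^+ 3 - 1))
      = (A + B * y ^+ 2) * (x ^+ 2 * (x ^+ 3 - 1)).
    by rewrite -Ex -Ey; ring.
  have x31 : 1 < x ^+ 3 by rewrite exprn_egt1.
  have h1 : x ^+ 2 * (x ^+ 3 - 1) < y ^+ 2 * (y ^+ 3 - 1).
    by apply: ltr_pM; rewrite ?subr_ge0 ?ltrD2r ?ltW.
  have h2 : x ^+ 2 * y ^+ 2 * (x ^+ 3 - 1) < x ^+ 2 * y ^+ 2 * (y ^+ 3 - 1).
    by rewrite ltr_pM2l ?ltrD2r // mulr_gt0 // exprn_gt0.
  rewrite -(ltr_pM2l A0) in h1; rewrite -(ltr_pM2l B0) in h2.
  lra.
by move=> Eu Ev; case: (ltgtP u v) => // H; exfalso; eapply inc; eauto.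
Qed.

Lemma ratio_exists (R : rcfType) (A B K : R) : 0 < A -> 0 < B -> 0 < K ->
  exists2 u : R, 1 < u & K * (u ^+ 5 - u ^+ 2) = A + B * u ^+ 2.
Proof.
move=> A0 B0 K0.
pose p : {poly R} := K%:P * ('X ^+ 5 - 'X ^+ 2) - A%:P - B%:P * 'X ^+ 2.
(* Chosen so that [K * (b - 1) = A + B]: then [K * (b ^+ 5 - b ^+ 2)] is at least
   [(A + B) * b ^+ 2], hence at least [A + B * b ^+ 2], and [p] changes sign on [[1, b]]. *)
pose b := 1 + (A + B) / K.
have k0 : 0 < (A + B) / K by rewrite divr_gt0 ?addr_gt0.
have [||u /andP[u1 ub] /rootP] := @poly_ivt R p 1 b.
- by rewrite lerDl ltW.
- rewrite !hornerE /=; apply/andP; split; first by nra.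
  have b1 : 1 <= b by rewrite lerDl ltW.
  have b2 : 1 <= b ^+ 2 by rewrite exprn_ege1.
  have bK : K * (b - 1) = A + B by rewrite /b; field; exact: lt0r_neq0.
  have b3 : b <= b ^+ 3 by rewrite exprS ler_peMr // (le_trans ler01).
  have h : K * (b - 1) * b ^+ 2 <= K * (b ^+ 3 - 1) * b ^+ 2.
    by apply: ler_wpM2r; [lra|apply: ler_wpM2l; [exact: ltW|lra]].
  rewrite bK in h; nra.
- rewrite !hornerE /= => E; exists u; last first.
    by apply/eqP; rewrite -subr_eq0 -[X in _ == X]E; apply/eqP; ring.
  (* The root is not 1, where [p] takes the value [- (A + B)]. *)
  rewrite lt_neqAle u1 andbT; apply/negP => /eqP u1'; move: E; rewrite -u1'; nra.
Qed.

Lemma shape_unique (R : realFieldType) (A B C r s r' s' : R) :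
  0 < A -> 0 < B -> 0 < C -> 0 < r -> 0 < s -> 0 < r' -> 0 < s' ->
  r ^- 3 = s ^- 3 + 3 * C * s ^- 5 -> r' ^- 3 = s' ^- 3 + 3 * C * s' ^- 5 ->
  A * r ^+ 2 + B * s ^+ 2 = A * r' ^+ 2 + B * s' ^+ 2 -> r = r' /\ s = s'.
Proof.
move=> A0 B0 C0 r0 s0 r'0 s'0 F F' EI.
have [u1 Eu] := ratio_gt1 C0 r0 s0 F; have [v1 Ev] := ratio_gt1 C0 r'0 s'0 F'.
have Es : s = r * (s / r) by field; exact: lt0r_neq0.
have Es' : s' = r' * (s' / r') by field; exact: lt0r_neq0.
have uv : s / r = s' / r'.
  (* Multiplying the moment of inertia by [u ^+ 5 - u ^+ 2] and using [ratio_gt1] removes the scale,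
     so both ratios solve one equation. *)
  apply: (@ratio_unique _ (3 * C * A) (3 * C * B) (A * r ^+ 2 + B * s ^+ 2)) => //.
  - by rewrite !mulr_gt0.
  - by rewrite !mulr_gt0.
  - by rewrite addr_gt0 // mulr_gt0 // exprn_gt0.
  - by rewrite {1}Es -Eu; ring.
  - by rewrite EI {1}Es' -Ev; ring.
(* Equal ratios leave the same factor [v ^+ 5 - v ^+ 2] on both squares; it is nonzero since
   [1 < v]. *)
move: Eu; rewrite uv -Ev => /mulIf -/(_ _)/eqP; rewrite eqrXn2 ?ltW // => E.
have rr : r = r'.
  apply/eqP/E; move: v1; set v := s' / r' => v1.
  have v2 : 1 < v ^+ 2 by rewrite exprn_egt1.
  have v3 : 1 < v ^+ 3 by rewrite exprn_egt1.
  have -> : v ^+ 5 - v ^+ 2 = v ^+ 2 * (v ^+ 3 - 1) by ring.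
  by rewrite lt0r_neq0 // mulr_gt0; lra.
by split=> //; rewrite Es Es' uv rr.
Qed.

Lemma shape_exists (R : rcfType) (A B C I : R) :
  0 < A -> 0 < B -> 0 < C -> 0 < I ->
  exists r s : R, [/\ 0 < r, r < s,
    r ^- 3 = s ^- 3 + 3 * C * s ^- 5 & A * r ^+ 2 + B * s ^+ 2 = I].
Proof.
move=> A0 B0 C0 I0.
have C3 : 0 < 3 * C by rewrite mulr_gt0.
have [u u1 Eu] := ratio_exists (mulr_gt0 C3 A0) (mulr_gt0 C3 B0) I0.
have u0 : 0 < u by lra.
have d0 : 0 < u ^+ 3 - 1 by rewrite subr_gt0 exprn_egt1.
have du0 : u != 0 by exact: lt0r_neq0.
(* The value that the force equation imposes on [r ^+ 2] once the ratio [u] is known. *)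
pose q := 3 * C / (u ^+ 2 * (u ^+ 3 - 1)).
have q0 : 0 < q by rewrite divr_gt0 // mulr_gt0 // exprn_gt0.
pose r := Num.sqrt q.
have r0 : 0 < r by rewrite sqrtr_gt0.
have r2 : r ^+ 2 = q by rewrite sqr_sqrtr // ltW.
exists r, (r * u); split=> //; first by rewrite ltr_pMr.
- have -> : 3 * C = r ^+ 2 * (u ^+ 2 * (u ^+ 3 - 1)).
    by rewrite r2 /q; field; rewrite du0 /= lt0r_neq0.
  by field; rewrite du0 /= lt0r_neq0.
- have -> : A * r ^+ 2 + B * (r * u) ^+ 2 = q * (A + B * u ^+ 2) by rewrite -r2; ring.
  have -> : q * (A + B * u ^+ 2) = (3 * C * A + 3 * C * B * u ^+ 2) / (u ^+ 2 * (u ^+ 3 - 1)).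
    by rewrite /q; field; rewrite du0 /= lt0r_neq0.
  by rewrite -Eu; field; rewrite du0 /= lt0r_neq0.
Qed.

(** * Realizing the triangle, and conclusion *)

Lemma isosceles_triangle_exists (R : realType) (m : 'rV[R]_3) (r s : R) :
  \sum_(i < 3) m 0 i = 1 -> 0 < r -> r < s ->
  exists z : 'M[R]_(3, 2),
    [/\ \sum_(i < 3) m 0 i *: row i z = 0, edge_det z != 0,
        edist z body1 body2 = r, edist z body1 body3 = s &
        edist z body2 body3 = s].
Proof.
rewrite [X in X = 1 -> _]sum_bodies => m1 r0 rs.
pose h := Num.sqrt (s ^+ 2 - (r / 2) ^+ 2).
have hq : 0 < s ^+ 2 - (r / 2) ^+ 2 by nra.
have h0 : 0 < h by rewrite sqrtr_gt0.
have h2 : h ^+ 2 = s ^+ 2 - (r / 2) ^+ 2 by rewrite sqr_sqrtr // ltW.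
(* The base lies on the first axis, centered at 0, and the apex [body3] at height [h]; its abscissa
   is the default 0 of [nth]. Subtracting [c] then moves the center of mass to the origin. *)
pose P (i : 'I_3) (k : 'I_2) : R :=
  if k == 0 then nth 0 [:: r / 2; - (r / 2)] i else nth 0 [:: 0; 0; h] i.
pose c k := m 0 body1 * P body1 k + m 0 body2 * P body2 k + m 0 body3 * P body3 k.
have dist (z : 'M[R]_(3, 2)) i j x : 0 <= x ->
    (z i 0 - z j 0) ^+ 2 + (z i 1 - z j 1) ^+ 2 = x ^+ 2 -> edist z i j = x.
  by move=> x0 E; rewrite edistE E sqrtr_sqr ger0_norm.
exists (\matrix_(i, k) (P i k - c k)); split.
- apply/center_of_massE => k; rewrite !mxE.
  transitivity (c k - (m 0 body1 + m 0 body2 + m 0 body3) * c k); first by rewrite /c; ring.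
  by rewrite m1 mul1r subrr.
- rewrite /edge_det !mxE /P /=.
  have -> a b : (r / 2 - a - (- (r / 2) - a)) * (0 - b - (h - b))
      - (0 - b - (0 - b)) * (r / 2 - a - (0 - a)) = - (r * h) by field.
  by rewrite oppr_eq0 mulf_neq0 // lt0r_neq0.
- by apply: dist; rewrite ?(ltW r0) // !mxE /P /=; field.
- apply: dist; first by rewrite ltW // (lt_trans r0).
  by rewrite !mxE /P /=; transitivity ((r / 2) ^+ 2 + h ^+ 2); [ring|rewrite h2; ring].
- apply: dist; first by rewrite ltW // (lt_trans r0).
  by rewrite !mxE /P /=; transitivity ((r / 2) ^+ 2 + h ^+ 2); [ring|rewrite h2; ring].
Qed.

Theorem proposition2p1 (R : realType) (m : 'rV[R]_3) (C Ibar : R)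
    (hm12 : m 0 body2 <= m 0 body1) (hm23 : m 0 body3 <= m 0 body2)
    (hm3 : 0 < m 0 body3) (hsum : \sum_(i < 3) m 0 i = 1)
    (hC : 0 < C) (hI : 0 < Ibar) :
  exists z : 'M[R]_(3, 2),
    [/\ central_configuration m C z,
        ~ collinear z,
        moment_of_inertia m z = Ibar,
        isosceles z &
        forall w : 'M[R]_(3, 2),
          central_configuration m C w -> ~ collinear w ->
          moment_of_inertia m w = Ibar ->
          congruent_about_origin z w].
Proof.
have m2 : 0 < m 0 body2 := lt_le_trans hm3 hm23.
have m1 : 0 < m 0 body1 := lt_le_trans m2 hm12.
have mp i : 0 < m 0 i by move: i; apply: bodyP.
(* With the two sides at [body3] equal to [s] and the third equal to [r], these are the coefficients
   of [r ^+ 2] and [s ^+ 2] in the moment of inertia. *)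
have A0 : 0 < m 0 body1 * m 0 body2 by exact: mulr_gt0.
have B0 : 0 < (m 0 body1 + m 0 body2) * m 0 body3 by rewrite mulr_gt0 ?addr_gt0.
have [r [s [r0 rs F EI]]] := shape_exists A0 B0 hC hI.
have [z [cm S0 z12 z13 z23]] := isosceles_triangle_exists hsum r0 rs.
have force0 x : x ^- 3 + 3 * 0 * x ^- 5 = x ^- 3 :> R by rewrite mulr0 mul0r addr0.
exists z; split.
- apply/(triangular_central_configurationP mp hsum (ltW hC) cm S0).
  by rewrite z12 z13 z23 force0.
- by move=> /collinear_edge_det0 E; rewrite E eqxx in S0.
- by rewrite moment_of_inertiaE // z12 z13 z23 -EI; ring.
- by apply: Or33; rewrite z13 z23.
move=> w ccw ncw Iw; have [inj cmw _] := ccw.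
have Sw : edge_det w != 0.
  apply/eqP => /edge_det0_collinear; apply: contra_not ncw => E; apply: E.
  by rewrite (inj_eq inj).
have /(triangular_central_configurationP mp hsum (ltW hC) cmw Sw)[] := ccw.
have posw i j (ij : i != j) : 0 < edist w i j by rewrite edist_gt0 // (inj_eq inj).
have w12 := posw body1 body2 isT.
have w13 := posw body1 body3 isT.
have w23 := posw body2 body3 isT.
rewrite force0 => Fw /(oblate_force_inj (ltW hC) w23 w13) E23.
have s0 := lt_trans r0 rs.
(* Both triangles satisfy the same force equation and have the same moment of inertia, so their
   sides agree. *)
have [|rE sE] := @shape_unique _ _ _ _ _ _ _ _ A0 B0 hC r0 s0 w12 w13 F Fw.
  by rewrite EI -Iw moment_of_inertiaE // E23; ring.
apply: (congruent_of_distances hsum cm cmw S0).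
by apply: bodyP; apply: bodyP;
  rewrite ?edistxx ?[edist _ body2 body1]edistC ?[edist _ body3 _]edistC
    ?z12 ?z13 ?z23 ?E23.
Qed.
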